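(* For a regular Hausdorff space $X$ the following are equivalent: (1) $X$ is an $\aleph$-space; (2) $\mathcal{F}_2(X)$ has a $\sigma$-HCP $k$-network; (3) $\mathcal{F}(X)$ has a $\sigma$-HCP $k$-network; (4) $\mathcal{F}(X)$ is an $\aleph$-space; (5) $\mathcal{K}(X)$ is an $\aleph$-space.
   Context: $\mathcal{K}(X)$ is the set of nonempty compact subsets of $X$ with the Vietoris topology (base: $\langle U_1,\dots,U_k\rangle=\{K: K\subset\bigcup_i U_i,\ K\cap U_j\neq\emptyset\ \forall j\}$, $U_i$ open in $X$); $\mathcal{F}(X)$ (nonempty finite subsets) and $\mathcal{F}_2(X)$ (nonempty subsets of cardinality at most 2) carry the subspace topology. A family $\mathcal{P}$ is a $k$-network if for every compact $K$ and open $U\supset K$ there is finite $\mathcal{P}'\subset\mathcal{P}$ with $K\subset\bigcup\mathcal{P}'\subset U$. A family $\mathcal{P}$ is hereditarily closure-preserving (HCP) if for any choice $S(P)\subset P$, $P\in\mathcal{P}$, the family $\{S(P)\}$ is closure-preserving (closure of any union of a subfamily equals the union of closures); $\sigma$-HCP means a countable union of HCP families. A space is an $\aleph$-space if it has a $\sigma$-locally finite $k$-network. *)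

(* Defs.v *)
From HB Require Import structures.
From mathcomp Require Import all_boot all_order.
From mathcomp Require Import boolp classical_sets functions cardinality topology.
Set Implicit Arguments. Unset Strict Implicit. Unset Printing Implicit Defensive.
Local Open Scope classical_set_scope.

Section Families.
Context {T : topologicalType}.

Definition k_network (Pf : set_system T) : Prop :=
  forall K U : set T, compact K -> open U -> K `<=` U ->
    exists Q : set_system T,
      [/\ finite_set Q, Q `<=` Pf,
          K `<=` \bigcup_(A in Q) A & \bigcup_(A in Q) A `<=` U].

Definition closure_preserving (Pf : set_system T) : Prop :=
  forall Q : set_system T, Q `<=` Pf ->
    closure (\bigcup_(A in Q) A) = \bigcup_(A in Q) closure A.

Definition HCP (Pf : set_system T) : Prop :=
  forall S : set T -> set T, (forall A, Pf A -> S A `<=` A) ->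
    closure_preserving (S @` Pf).

Definition sigma_HCP (Pf : set_system T) : Prop :=
  exists F : nat -> set_system T,
    (forall n, HCP (F n)) /\ Pf = \bigcup_n F n.

Definition locally_finite_family (Pf : set_system T) : Prop :=
  forall x : T, exists N : set T,
    nbhs x N /\ finite_set [set A | Pf A /\ A `&` N !=set0].

Definition sigma_locally_finite (Pf : set_system T) : Prop :=
  exists F : nat -> set_system T,
    (forall n, locally_finite_family (F n)) /\ Pf = \bigcup_n F n.

Definition aleph_space : Prop :=
  exists Pf : set_system T, sigma_locally_finite Pf /\ k_network Pf.

End Families.
Arguments aleph_space T : clear implicits.

Definition vietoris_basic {X : topologicalType} (k : nat) (U : 'I_k -> set X)
  : set (set X) :=
  [set K | (K `<=` \bigcup_i U i) /\ (forall j, K `&` U j !=set0)].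

Definition hyperspace (X : topologicalType) (P : set X -> Prop) : Type :=
  {A : set X | P A}.

Section Hyperspace.
Context (X : topologicalType) (P : set X -> Prop).
Local Notation H := (hyperspace P).

HB.instance Definition _ := gen_eqMixin H.
HB.instance Definition _ := gen_choiceMixin H.

Definition vietoris_subbase : set_system H :=
  [set V | exists (k : nat) (U : 'I_k -> set X),
      (forall i, open (U i)) /\
      V = [set A : H | vietoris_basic U (proj1_sig A)]].

HB.instance Definition _ := isSubBaseTopological.Build H vietoris_subbase id.
End Hyperspace.

Definition cpt_ne {X : topologicalType} (A : set X) : Prop :=
  compact A /\ A !=set0.
Definition fin_ne {X : topologicalType} (A : set X) : Prop :=
  finite_set A /\ A !=set0.
Definition atmost2_ne {X : topologicalType} (A : set X) : Prop :=
  exists x y : X, A = [set x] `|` [set y].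

Definition hyperK (X : topologicalType) : topologicalType := hyperspace (@cpt_ne X).
Definition hyperF (X : topologicalType) : topologicalType := hyperspace (@fin_ne X).
Definition hyperF2 (X : topologicalType) : topologicalType := hyperspace (@atmost2_ne X).

(* Main.v *)
(* Every hyperspace [H] lying between [F_2(X)] and [K(X)] is treated at once.

   From [X] to [H]: if [F n] is locally finite in [X], so is in [H] the family of
   all [bracket Q], [Q] a finite part of [F n], and these brackets form a k-network.

   From [H] to [X]: if every compact subset of [X] is finite, a k-network is just
   a network and the Siwiec-Nagata argument applies.  Otherwise a compact set
   contains distinct points [c 0, c 1, ...] accumulating at some [a].  An HCP family
   in [H] is point-finite at all but finitely many points of any compact set, in
   particular on [{ {y, c i} | y in K }] for some [i].  Hence the traces of
   the family on the copy [y |-> {y, c i}] of [X] are, near [K], point-finite, and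
   an HCP family is locally finite wherever its closures are point-finite. *)
Require Import Defs.
From HB Require Import structures.
From mathcomp Require Import all_boot all_order.
From mathcomp Require Import finmap.
From mathcomp Require Import boolp classical_sets functions cardinality topology.
Set Implicit Arguments. Unset Strict Implicit. Unset Printing Implicit Defensive.
Local Open Scope classical_set_scope.

(** * Preliminaries on compactness and finite sets *)

(** If [Phi K] failed, the sets whose complement in [K] satisfies [Phi] would form a proper filter
    containing [K], hence clustering at a point of [K]; the neighbourhood given at that point is a
    contradiction. *)
Lemma compact_ind (T : topologicalType) (K : set T) (Phi : set T -> Prop) :
  compact K -> Phi set0 ->
  (forall A B, Phi A -> Phi B -> Phi (A `|` B)) ->
  (forall A B, A `<=` B -> Phi B -> Phi A) ->
  (forall x, K x -> exists2 N, nbhs x N & Phi (N `&` K)) -> Phi K.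
Proof.
move=> cptK Phi0 PhiU PhiS PhiK; apply: contrapT => nPhi.
pose F : set_system T := [set A | Phi (K `\` A)].
have FF : ProperFilter F.
  split; first by rewrite /F /= setD0.
  split; first by rewrite /F /= setDT.
  - by move=> A B FA FB; rewrite /F /= setDIr; exact: PhiU.
  - by move=> A B AB; apply: PhiS; exact: setDS.
have [x [Kx xF]] := cptK F FF (ltac:(by rewrite /F /= setDv)).
have [N xN PhiN] := PhiK x Kx.
have FN : F (~` N) by rewrite /F /= setDE setCK setIC.
by have [y [nNy]] := xF _ _ FN xN.
Qed.

Lemma nbhs_open (T : topologicalType) (x : T) (N : set T) : nbhs x N ->
  exists U, [/\ open U, U x & U `<=` N].
Proof. by rewrite nbhsE => -[U [oU Ux] UN]; exists U. Qed.

Lemma disjoint_not_closure (T : topologicalType) (x : T) (A U : set T) :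
  nbhs x U -> U `&` A = set0 -> ~ closure A x.
Proof. by move=> xU UA /(_ U xU) [y [Ay Uy]]; have : set0 y by rewrite -UA. Qed.

Lemma hausdorff_sep (T : topologicalType) (x y : T) : hausdorff_space T ->
  x <> y -> exists U, [/\ open U, U x & ~ closure U y].
Proof.
rewrite open_hausdorff => h /eqP /h [[U V] /= [/set_mem Ux /set_mem Vy] [oU oV /eqP UV]].
exists U; split=> //; apply: (@disjoint_not_closure _ _ _ V); last by rewrite setIC.
exact: open_nbhs_nbhs.
Qed.

Lemma regular_open (T : topologicalType) (x : T) (U : set T) : regular_space T ->
  open U -> U x -> exists V, [/\ open V, V x & closure V `<=` U].
Proof.
move=> rT oU Ux; have [W xW WU] := rT x U (open_nbhs_nbhs (conj oU Ux)).
have [V [oV Vx VW]] := nbhs_open xW; exists V; split=> //.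
exact: subset_trans (closureS VW) WU.
Qed.

Lemma regular_compact (T : topologicalType) (K U : set T) : regular_space T ->
  compact K -> open U -> K `<=` U ->
  exists V, [/\ open V, K `<=` V & closure V `<=` U].
Proof.
move=> rT cptK oU KU; apply: (compact_ind (Phi := fun A => exists V,
    [/\ open V, A `<=` V & closure V `<=` U])) => //.
- by exists set0; split; [exact: open0|by []|rewrite closure0].
- move=> A B [V [oV AV VU]] [W [oW BW WU]]; exists (V `|` W).
  by split; [exact: openU|exact: setUSS|rewrite closureU subUset].
- by move=> A B AB [V [oV BV VU]]; exists V; split=> //; exact: subset_trans BV.
- move=> x /KU Ux; have [V [oV Vx VU]] := regular_open rT oU Ux.
  by exists V; [exact: open_nbhs_nbhs|exists V; split=> // y []].
Qed.

Lemma compact_accumulation (T : topologicalType) (K : set T) (c : nat -> T) :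
  compact K -> (forall i, K (c i)) ->
  exists x : T, forall N, nbhs x N -> infinite_set [set i | N (c i)].
Proof.
move=> cptK Kc; apply: contrapT => /forallNP h.
have : finite_set [set i | K (c i)].
  apply: (compact_ind (Phi := fun A => finite_set [set i | A (c i)])) => //.
  - by move=> A B fA fB; have := conj fA fB; rewrite -finite_setU.
  - by move=> A B AB; apply: sub_finite_set => i; exact: AB.
  - move=> x _; have /existsNP[N /not_implyP[xN /contrapT fN]] := h x.
    by exists N => //; apply: sub_finite_set fN => i [].
have -> : [set i | K (c i)] = setT by apply/seteqP; split=> i _ /=.
exact: infinite_nat.
Qed.

Lemma infinite_choice (T : eqType) (A : nat -> set T) :
  (forall i, infinite_set (A i)) ->
  exists f : nat -> T, injective f /\ forall i, A i (f i).
Proof.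
move=> Ainf.
have pick (p : seq T * nat) : exists x, A p.2 x /\ x \notin p.1.
  have [x [Ax xs]] : (A p.2 `\` [set` p.1]) !=set0.
    by apply: infinite_setN0; apply: infinite_setD => //; exact: finite_seq.
  by exists x; split=> //; apply/negP.
have [g gP] := choice pick.
(* [s n] lists the values chosen before stage [n], latest first; [g (s n, n)] is the next one. *)
pose s := fix s n := if n is m.+1 then g (s m, m) :: s m else [::].
have s_sub m n : m < n -> g (s m, m) \in s n.
  elim: n => // n IH; rewrite ltnS leq_eqVlt inE => /orP[/eqP->|/IH->].
    by rewrite eqxx.
  by rewrite orbT.
have gN m n : m < n -> g (s m, m) <> g (s n, n).
  by move=> /s_sub mn e; have [_ /=] := gP (s n, n); rewrite -e mn.
exists (fun n => g (s n, n)); split=> [m n e|n]; last by have [] := gP (s n, n).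
by case: (ltngtP m n) => [/gN|/gN|//]; rewrite e.
Qed.

Lemma finite_set_sub_bigcup (T : choiceType) (F : nat -> set T) (Q : set T) :
  (forall m n, m <= n -> F m `<=` F n) -> finite_set Q ->
  Q `<=` \bigcup_n F n -> exists n, Q `<=` F n.
Proof.
move=> Fmono /finite_seqP [s ->]; elim: s => [|x s IH] sF; first by exists 0.
have [|n sn] := IH; first by move=> y /= ys; apply: sF; rewrite /= inE ys orbT.
have [|m _ Fx] := sF x; first by rewrite /= inE eqxx.
exists (maxn m n) => y /=; rewrite inE => /orP[/eqP->|/sn].
  by apply: (Fmono _ _ _ _ Fx); exact: leq_maxl.
by apply: Fmono; exact: leq_maxr.
Qed.

Lemma finite_subsets (T : choiceType) (Q : set T) :
  finite_set Q -> finite_set [set R | R `<=` Q].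
Proof.
move=> fQ; apply: (@sub_finite_set _ _
    ((fun B : {fset T} => [set` B]) @` [set` fpowerset (fset_set Q)])).
  move=> R /= RQ; have fR : finite_set R by exact: sub_finite_set fQ.
  exists (fset_set R); last exact: fset_setK.
  by rewrite /= fpowersetE -fset_set_sub.
exact/finite_image/finite_fset.
Qed.

Lemma finite_fiber (S T : Type) (f : S -> T) (y : T) :
  injective f -> finite_set [set x | f x = y].
Proof.
move=> finj; have [[x fx]|nx] := pselect (exists x, f x = y).
  by apply: sub_finite_set (finite_set1 x) => z /= fz; apply: finj; rewrite fz.
by rewrite (_ : [set _ | _] = set0) // -subset0 => x /= fx; apply: nx; exists x.
Qed.

(** Stages may thus be taken increasing, so that a finite subfamily of the union lies in a single
    stage. *)
Lemma bigcup_increasing (T : Type) (p : set T -> Prop) (F : nat -> set T) :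
  (forall n, p (F n)) -> (forall A B, p A -> p B -> p (A `|` B)) ->
  exists G : nat -> set T, [/\ forall n, p (G n),
    forall m n, m <= n -> G m `<=` G n & \bigcup_n F n = \bigcup_n G n].
Proof.
move=> pF pU; pose G := fix G n := if n is m.+1 then G m `|` F m.+1 else F 0.
have GS n : G n `<=` G n.+1 by move=> x; left.
have FG n : F n `<=` G n by case: n => // n x; right.
exists G; split.
- by elim=> [|n IH]; [exact: pF|apply: pU].
- move=> m n; elim: n => [|n IH]; first by rewrite leqn0 => /eqP ->.
  by rewrite leq_eqVlt => /orP[/eqP-> //|/IH]; move=> h x /h; exact: GS.
- apply/seteqP; split; first by move=> x [n _ Fx]; exists n => //; exact: FG.
  apply: bigcup_sub => n _; elim: n => [|n IH]; first by move=> x Fx; exists 0.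
  by move=> x [/IH //|Fx]; exists n.+1.
Qed.

(** * Hereditarily closure-preserving and locally finite families *)

Section families.
Variable T : topologicalType.
Implicit Types F G Q : set_system T.

Lemma HCP_closure F (S : set T -> set T) : HCP F ->
  (forall A, F A -> S A `<=` A) ->
  forall x, closure (\bigcup_(A in F) S A) x -> exists2 A, F A & closure (S A) x.
Proof.
move=> hF SA x; have := hF S SA _ (@subset_refl _ _).
rewrite !bigcup_image => -> [A FA Ax]; by exists A.
Qed.

(** Only the union of the whole family has to be tested: a subfamily is obtained by shrinking the
    unwanted members to the empty set. *)
Lemma HCP_intro F :
  (forall S : set T -> set T, (forall A, F A -> S A `<=` A) ->
  forall x, closure (\bigcup_(A in F) S A) x ->
    exists2 A, F A & closure (S A) x) -> HCP F.
Proof.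
move=> hF S SA Q QS; apply/seteqP; split; last first.
  by apply: bigcup_sub => A QA; apply: closureS; exact: bigcup_sup.
move=> x clx; pose S' A := [set y | S A y /\ Q (S A)].
have QS' : \bigcup_(A in Q) A `<=` \bigcup_(A in F) S' A.
  move=> y [B QB By]; have [A FA SAB] := QS _ QB.
  by exists A => //; rewrite /S' /= SAB.
have [|A FA S'x] := hF S' _ x (closureS QS' clx).
  by move=> A FA y [Sy _]; exact: SA Sy.
have [y [[_ QSA] _]] := S'x setT filterT.
exists (S A) => //; have /closureS : S' A `<=` S A by move=> z [].
exact.
Qed.

Lemma HCP_setU F G : HCP F -> HCP G -> HCP (F `|` G).
Proof.
move=> hF hG; apply: HCP_intro => S SA x.
rewrite bigcup_setU closureU => -[clx|clx].
- have [|A FA Ax] := HCP_closure hF _ clx; last by exists A => //; left.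
  by move=> A FA; apply: SA; left.
- have [|A GA Ax] := HCP_closure hG _ clx; last by exists A => //; right.
  by move=> A GA; apply: SA; right.
Qed.

Lemma HCP_bigcup_closed F G : HCP F -> G `<=` F ->
  closed (\bigcup_(A in G) closure A).
Proof.
move=> hF GF; have := hF id (fun _ _ => @subset_refl _ _).
by rewrite image_id => /(_ _ GF) <-; exact: closed_closure.
Qed.

Lemma HCP_nbhs F x : HCP F ->
  exists U, [/\ open U, U x & forall A, F A -> U `&` closure A !=set0 -> closure A x].
Proof.
move=> hF; pose G := [set A | F A /\ ~ closure A x].
have cG : closed (\bigcup_(A in G) closure A).
  by apply: (HCP_bigcup_closed hF) => A [].
exists (~` \bigcup_(A in G) closure A); split.
- exact: closed_openC.
- by case=> A [_].
- move=> A FA [y [nGy Ay]]; apply: contrapT => nAx.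
  by apply: nGy; exists A.
Qed.

Lemma locally_finite_HCP F : locally_finite_family F -> HCP F.
Proof.
move=> lF; apply: HCP_intro => S SA x clx; apply: contrapT => nS.
have [N [xN fN]] := lF x.
have cE : closed (\bigcup_(A in [set A | F A /\ A `&` N !=set0]) closure (S A)).
  by apply: closed_bigcup => // A _; exact: closed_closure.
have xE : nbhs x (~` \bigcup_(A in [set A | F A /\ A `&` N !=set0]) closure (S A)).
  apply: open_nbhs_nbhs; split; first exact: closed_openC.
  by case=> A [FA _] Ax; apply: nS; exists A.
have [y [[A FA Ay] [nEy Ny]]] := clx _ (filterI xE xN).
apply: nEy; exists A; last exact: subset_closure.
by split=> //; exists y; split=> //; exact: SA Ay.
Qed.

Lemma locally_finite_setU F G : locally_finite_family F ->
  locally_finite_family G -> locally_finite_family (F `|` G).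
Proof.
move=> lF lG x; have [M [xM fM]] := lF x; have [N [xN fN]] := lG x.
exists (M `&` N); split; first exact: filterI.
have /(@sub_finite_set _ _ _) : [set A | (F `|` G) A /\ A `&` (M `&` N) !=set0] `<=`
  [set A | F A /\ A `&` M !=set0] `|` [set A | G A /\ A `&` N !=set0].
  by move=> A [[FA|GA] [y [Ay [My Ny]]]]; [left|right]; split=> //; exists y.
by apply; rewrite finite_setU.
Qed.

Lemma aleph_sigma_HCP : aleph_space T ->
  exists Pf : set_system T, sigma_HCP Pf /\ k_network Pf.
Proof.
move=> [Pf [[F [lF ->]] kF]]; exists (\bigcup_n F n); split=> //.
by exists F; split=> // n; exact: locally_finite_HCP.
Qed.

Lemma aleph_countable (I : countType) (F : I -> set_system T) :
  (forall i, locally_finite_family (F i)) -> k_network (\bigcup_i F i) ->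
  aleph_space T.
Proof.
move=> lF kF; exists (\bigcup_i F i); split=> //.
(* Numbers that code no index receive the empty family. *)
exists (fun n : nat => oapp F set0 (@choice.unpickle I n)); split.
  move=> n; case: choice.unpickle => [i|] //= x; exists setT; split; first exact: filterT.
  by rewrite (_ : [set _ | _] = set0) // -subset0 => A [].
apply/seteqP; split=> A [i _ FA]; first by exists (choice.pickle i); rewrite ?choice.pickleK.
by move: FA; case: choice.unpickle => [j|] //= FA; exists j.
Qed.

(** Stated with closures so that, for an HCP family, this set is closed and the closures are locally
    finite off it. *)
Definition non_point_finite F : set T :=
  [set x | infinite_set [set A | F A /\ closure A x]].

Lemma closed_non_point_finite F : HCP F -> closed (non_point_finite F).
Proof.
move=> hF x clx; have [U [oU Ux UF]] := HCP_nbhs x hF.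
have [y [Dy Uy]] := clx U (open_nbhs_nbhs (conj oU Ux)).
apply: sub_infinite_set Dy => A [FA Ay]; split=> //.
by apply: UF => //; exists y.
Qed.

(** Around a point of [E], [HCP_nbhs] gives an open set meeting only the finitely many closures
    through that point; around any other point the complement of [E] works. *)
Lemma locally_finite_closureI F (E : set T) : HCP F -> closed E ->
  E `&` non_point_finite F = set0 ->
  locally_finite_family ((fun A => closure A `&` E) @` F).
Proof.
move=> hF cE ED x; have [Ex|nEx] := pselect (E x); last first.
  exists (~` E); split; first by apply: open_nbhs_nbhs; split=> //; exact: closed_openC.
  rewrite (_ : [set _ | _] = set0) // -subset0 => _ [[A FA <-]].
  by move=> [y [[_ Ey] nEy]].
have fx : finite_set [set A | F A /\ closure A x].
  by apply: contrapT => Dx; have : set0 x by rewrite -ED.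
have [U [oU Ux UF]] := HCP_nbhs x hF.
exists U; split; first exact: open_nbhs_nbhs.
apply: sub_finite_set (finite_image (fun A => closure A `&` E) fx).
move=> _ [[A FA <-] [y [[Ay _] Uy]]]; exists A => //; split=> //.
by apply: UF => //; exists y.
Qed.

(** Otherwise distinct points [d i] of the set accumulate at some [x], and distinct members [A i]
    can be chosen with [d i] in their closures. Cutting [A i] down to a neighbourhood of [d i] whose
    closure misses [x] leaves [x] in the closure of the union but of no single piece, against
    HCP. *)
Lemma finite_non_point_finite F (K : set T) : hausdorff_space T -> HCP F ->
  compact K -> finite_set (non_point_finite F `&` K).
Proof.
move=> hT hF cptK; apply: contrapT => infD.
have [d [dinj dD]] := infinite_choice (fun=> infD).
have [x xd] := compact_accumulation cptK (fun i => (dD i).2).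
have [A [Ainj AF]] := infinite_choice (fun i => (dD i).1).
have sep i : exists V, d i <> x -> [/\ open V, V (d i) & ~ closure V x].
  have [->|dx] := pselect (d i = x); first by exists set0.
  by have [V hV] := hausdorff_sep hT dx; exists V.
have [V hV] := choice sep.
pose S B := B `&` [set y | exists i, [/\ B = A i, d i <> x & V i y]].
have SB B : F B -> S B `<=` B by move=> _ y [].
have clx : closure (\bigcup_(B in F) S B) x.
  move=> N /nbhs_open[W [oW Wx WN]].
  have [i [Wi dix]] : ([set i | W (d i)] `\` [set i | d i = x]) !=set0.
    apply: infinite_setN0; apply: infinite_setD; last exact: finite_fiber.
    exact: (xd _ (open_nbhs_nbhs (conj oW Wx))).
  have [oV Vd _] := hV i dix.
  have [y [Ay [Wy Vy]]] := (AF i).2 _ (open_nbhs_nbhs (conj (openI oW oV) (conj Wi Vd))).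
  exists y; split; last exact: WN.
  by exists (A i); [exact: (AF i).1|split=> //; exists i].
have [B FB SBx] := HCP_closure hF SB clx.
have [_ [[_ [i [BA dx _]]] _]] := SBx setT filterT.
have SV : S B `<=` V i by move=> y [_ [j [BAj _ Vj]]]; rewrite (Ainj i j) // -BA.
by have [_ _] := hV i dx; apply; exact: closureS SV _ SBx.
Qed.

End families.

(** * Pullbacks along continuous maps *)

Section preimage.
Variables (X Y : topologicalType) (f : X -> Y).
Hypothesis fcont : continuous f.

Lemma closure_image (A : set X) (x : X) : closure A x -> closure (f @` A) (f x).
Proof.
move=> Ax N /fcont /Ax [y [Ay Ny]]; exists (f y); split=> //; exact: imageP.
Qed.

(** The condition on neighbourhoods says that [X] carries the topology induced by [f]. A shrinking
    of the preimages is pushed forward to a shrinking in [Y], and the closure point found there is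
    pulled back. *)
Lemma HCP_preimage (F : set_system Y) :
  (forall x U, nbhs x U -> exists2 V, nbhs (f x) V & f @^-1` V `<=` U) ->
  HCP F -> HCP ((fun A => f @^-1` A) @` F).
Proof.
move=> finit hF; apply: HCP_intro => S SA x.
rewrite bigcup_image => /closure_image; rewrite image_bigcup => clx.
have SF A : F A -> f @` S (f @^-1` A) `<=` A.
  by move=> FA _ [y Sy <-]; apply: (SA _ _ y Sy); exists A.
have [A FA fA] := HCP_closure hF SF clx.
exists (f @^-1` A); first by exists A.
move=> U /finit[V fxV VU]; have [_ [[y Sy <-] Vy]] := fA V fxV.
by exists y; split=> //; exact: VU.
Qed.

Lemma non_point_finite_preimage (F : set_system Y) (x : X) :
  non_point_finite ((fun A => f @^-1` A) @` F) x -> non_point_finite F (f x).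
Proof.
apply: contra_not => fin; apply: sub_finite_set (finite_image (fun A => f @^-1` A) fin).
move=> _ [[A FA <-] Ax]; exists A => //; split=> //.
by apply: closureS (closure_image Ax) => _ [y Ay <-].
Qed.

End preimage.

(* Siwiec-Nagata: the members of [F n] whose closure contains a given point split
   [T] into classes; shrinking each class to the members of [F m] inside the open
   set [V n M] below makes the family of classes discrete. *)
Lemma aleph_finite_compacts (T : topologicalType) : regular_space T ->
  (forall K : set T, compact K -> finite_set K) ->
  (exists Pf : set_system T, sigma_HCP Pf /\ k_network Pf) -> aleph_space T.
Proof.
move=> rT cptfin [_ [[F [hF ->]] kF]].
pose sig n (x : T) := [set B | F n B /\ closure B x].
(* [V n M] is the set of points [y] with [sig n y] contained in [M]; HCP makes it open. *)
pose V n (M : set_system T) := ~` \bigcup_(B in [set B | F n B /\ ~ M B]) closure B.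
pose E (nm : nat * nat) M := [set y | sig nm.1 y = M /\
  exists B, [/\ F nm.2 B, closure B `<=` V nm.1 M & closure B y]].
have oV n M : open (V n M).
  by apply/closed_openC/(HCP_bigcup_closed (hF n)) => B [].
have Vsig n x : V n (sig n x) x by move=> [B [FB nB] Bx]; apply: nB.
have VsigS n x M : V n M x -> sig n x `<=` M.
  by move=> Vx B [FB Bx]; apply: contrapT => nMB; apply: Vx; exists B.
have net x U : open U -> U x -> exists n, exists2 B, F n B & B x /\ closure B `<=` U.
  move=> oU Ux; have [W [oW Wx WU]] := regular_open rT oU Ux.
  have [|Q [_ QF xQ QW]] := kF [set x] W (@compact_set1 _ x) oW.
    by move=> _ ->.
  have [B QB Bx] := xQ x erefl; have [n _ FB] := QF _ QB.
  exists n, B => //; split=> //; apply: subset_trans WU.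
  by apply/closureS/(subset_trans _ QW)/bigcup_sup.
apply: (@aleph_countable _ _ (fun nm => range (E nm))) => [[n m] x|K U cptK oU KU].
  (* Off [C], a class [M] that is met must have [x] in [V n M], so [sig n x] is contained in [M];
     inside [V n (sig n x)] the reverse inclusion holds. Only the class of [x] remains. *)
  pose C := \bigcup_(B in [set B | F m B /\
    exists M, closure B `<=` V n M /\ ~ V n M x]) closure B.
  have oC : open (~` C) by apply/closed_openC/(HCP_bigcup_closed (hF m)) => B [].
  have nCx : (~` C) x by move=> [B [_ [M [BM nMx]]] /BM].
  exists (~` C `&` V n (sig n x)); split.
    apply: open_nbhs_nbhs; split; [exact: openI|by split].
  apply: sub_finite_set (finite_set1 (E (n, m) (sig n x))).
  move=> _ [[M _ <-] [y [[/= syM [B [FB BM By]]] [nCy Vy]]]].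
  have Mx : M `<=` sig n x by rewrite -syM; exact: VsigS.
  have xM : V n M x by apply: contrapT => nMx; apply: nCy; exists B => //; split=> //; exists M.
  by congr E; apply/seteqP; split=> //; exact: VsigS.
(* Compact sets are finite here, so one class inside [U] per point of [K] suffices; off [K] the
   value is a dummy. *)
have pt x : exists A, K x -> [/\ (\bigcup_nm range (E nm)) A, A x & A `<=` U].
  have [Kx|] := pselect (K x); last by exists set0.
  have [n [B FB [Bx BU]]] := net x U oU (KU x Kx).
  have [m [B' FB' [B'x B'V]]] := net x _ (oV n (sig n x)) (Vsig n x).
  exists (E (n, m) (sig n x)) => _; split.
  - by exists (n, m) => //; exists (sig n x).
  - by split=> //; exists B'; split=> //; exact: subset_closure.
  - move=> y [/= syx _]; apply: BU.
    have : sig n x B by split=> //; exact: subset_closure.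
    by rewrite -syx => -[].
have [g gP] := choice pt.
exists (g @` K); split.
- exact/finite_image/cptfin.
- by move=> _ [x /gP[? _ _] <-].
- by move=> x Kx; exists (g x); [exact: imageP|have [] := gP x Kx].
- by move=> y [_ [x /gP[_ _ gU] <-]] /gU.
Qed.

(** * The Vietoris topology *)

Section hyperspace_topology.
Variables (X : topologicalType) (P : set X -> Prop).
Hypothesis P_ne : forall A, P A -> A !=set0.
Local Notation H := (hyperspace P).

Lemma vietoris_subbase_open (V : set H) : vietoris_subbase V -> open V.
Proof.
move=> bV; exists [set V]; last by rewrite bigcup_set1.
by move=> _ ->; exact: finI_from1.
Qed.

Lemma open_upper (U : set X) : open U -> open [set A : H | proj1_sig A `<=` U].
Proof.
move=> oU; apply: vietoris_subbase_open; exists 1, (fun=> U); split=> //.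
apply/seteqP; split=> A /=.
  move=> AU; split; first by move=> x /AU; exists ord0.
  by have [x Ax] := P_ne (proj2_sig A); exists x; split=> //; exact: AU.
by move=> [AU _] x /AU [].
Qed.

Lemma open_lower (U : set X) : open U -> open [set A : H | proj1_sig A `&` U !=set0].
Proof.
move=> oU; apply: vietoris_subbase_open.
exists 2, (fun i => if i == ord0 then setT else U); split.
  by move=> i; case: ifP => // _; exact: openT.
apply/seteqP; split=> A /=.
  move=> AU; split=> [x _|j]; first by exists ord0.
  by case: ifP => // _; have [x Ax] := P_ne (proj2_sig A); exists x.
by move=> [_ /(_ ord_max)].
Qed.

(** Neighbourhoods are normalised to one containment and a finite list of meeting conditions; this
    form survives finite intersections, by intersecting the containments and concatenating the
    lists. *)
Lemma hyperspace_nbhs (A : H) (N : set H) : nbhs A N ->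
  exists (U : set X) (s : seq (set X)),
  [/\ open U, proj1_sig A `<=` U,
     forall V, V \in s -> open V /\ proj1_sig A `&` V !=set0 &
     forall B : H, proj1_sig B `<=` U ->
       (forall V, V \in s -> proj1_sig B `&` V !=set0) -> N B].
Proof.
move=> /nbhs_open [_ [[D DI <-] [W DW WA] DN]].
have [E Esub EW] := DI _ DW.
suff [U [s [oU AU sA hB]]] : exists (U : set X) (s : seq (set X)),
  [/\ open U, proj1_sig A `<=` U,
     forall V, V \in s -> open V /\ proj1_sig A `&` V !=set0 &
     forall B : H, proj1_sig B `<=` U ->
       (forall V, V \in s -> proj1_sig B `&` V !=set0) ->
       forall V, V \in (E : seq _) -> V B].
  exists U, s; split=> // B BU Bs; apply: DN; exists W => //; rewrite -EW.
  exact: hB.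
have {Esub} Eb V : V \in (E : seq _) -> vietoris_subbase V /\ V A.
  move=> VE; split; first by apply/set_mem/Esub.
  by move: WA; rewrite -EW; apply.
elim: {W D DI DN DW EW WA} (E : seq _) Eb => [_|V s IH Vb].
  by exists setT, [::]; split=> //; exact: openT.
have [|U [t [oU AU tA hB]]] := IH.
  by move=> W Ws; apply: Vb; rewrite inE Ws orbT.
have [[k [G [oG VG]]]] := Vb V (mem_head _ _).
rewrite {1}VG => -[AG GA].
exists (U `&` \bigcup_i G i), (codom G ++ t); split.
- by apply: openI => //; exact: bigcup_open.
- by move=> x Ax; split; [exact: AU|exact: AG].
- by move=> W; rewrite mem_cat => /orP[/codomP[i ->]|/tA //]; split; [exact: oG|exact: GA].
- move=> B BU Bs W; rewrite inE => /orP[/eqP ->|].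
    rewrite VG; split; first by move=> x /BU [].
    by move=> j; apply: Bs; rewrite mem_cat codom_f.
  apply: hB; first by move=> x /BU [].
  by move=> Z Zt; apply: Bs; rewrite mem_cat Zt orbT.
Qed.

End hyperspace_topology.

(** * From [X] to its hyperspaces *)

Section aleph_hyperspace.
Variables (X : topologicalType) (P : set X -> Prop).
Hypothesis P_cpt : forall A, P A -> cpt_ne A.
Local Notation H := (hyperspace P).

Let P_ne A : P A -> A !=set0. Proof. by move=> /P_cpt[]. Qed.

(** A filter without cluster point in the union has, by compactness of each [A] in [K], a member
    missing an open set around [A], hence missing all elements of [H] near [A]. Compactness of [K]
    then yields one member missing the whole union. *)
Lemma compact_bigcup_hyperspace (K : set H) : compact K ->
  compact (\bigcup_(A in K) proj1_sig A).
Proof.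
move=> cptK F FF FK; apply: contrapT => nF.
have {nF} nF x : (\bigcup_(A in K) proj1_sig A) x ->
    exists N B, [/\ nbhs x N, F B & B `&` N = set0].
  move=> Kx; apply: contrapT => h; apply: nF; exists x; split=> // B N FB xN.
  apply/set0P/eqP => BN; apply: h; by exists N, B.
suff [B FB BK] : exists2 B, F B &
    forall A, K A -> B `&` proj1_sig A = set0.
  have [y [By [A KA Ay]]] := filter_ex (filterI FB FK).
  by have : set0 y by rewrite -(BK A KA).
apply: (compact_ind (K := K) (Phi := fun C => exists2 B, F B &
    forall A, C A -> B `&` proj1_sig A = set0)) => //.
- by exists setT => //; exact: filterT.
- move=> C D [B FB BC] [B' FB' BD]; exists (B `&` B'); first exact: filterI.
  by move=> A [/BC|/BD]; apply: subsetI_eq0; do ?[by []|by move=> y []].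
- by move=> C D CD [B FB BD]; exists B => // A /CD /BD.
- move=> A KA.
  have [V [oV AV] [B FB BV]] : exists2 V, open V /\ proj1_sig A `<=` V &
      exists2 B, F B & B `&` V = set0.
    apply: (compact_ind (K := proj1_sig A) (Phi := fun C => exists2 V,
      open V /\ C `<=` V & exists2 B, F B & B `&` V = set0)) => //.
    + by have [] := P_cpt (proj2_sig A).
    + by exists set0; [split; [exact: open0|]|exists setT; [exact: filterT|rewrite setI0]].
    + move=> C D [V [oV CV] [B FB BV]] [W [oW DW] [B' FB' BW]].
      exists (V `|` W); first by split; [exact: openU|exact: setUSS].
      exists (B `&` B'); first exact: filterI.
      by rewrite setIUr -[RHS]setU0; congr (_ `|` _); [move: BV|move: BW];
        apply: subsetI_eq0; do ?[by []|by move=> y []].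
    + by move=> C D CD [V [oV DV] hV]; exists V => //; split=> //; exact: subset_trans DV.
    + move=> x Ax; have [|N [B [xN FB BN]]] := nF x; first by exists A.
      have [W [oW Wx WN]] := nbhs_open xN.
      exists W; first exact: open_nbhs_nbhs.
      exists W; first by split=> // y [].
      by exists B => //; apply: subsetI_eq0 BN.
  exists [set A : H | proj1_sig A `<=` V].
    by apply: open_nbhs_nbhs; split=> //; exact: open_upper.
  by exists B => // A' [A'V _]; apply: subsetI_eq0 BV.
Qed.

(** The Vietoris formula applied to an arbitrary family of sets, open or not. *)
Definition bracket (Q : set_system X) : set H :=
  [set A | proj1_sig A `<=` \bigcup_(B in Q) B /\
           forall B, Q B -> proj1_sig A `&` B !=set0].

(** The compact set [A] has an open neighbourhood [V] meeting only finitely many members. If a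
    bracket contains a subset of [V], all sets in [Q] meet [V], which leaves finitely many choices
    of [Q]. *)
Lemma locally_finite_bracket (F : set_system X) : locally_finite_family F ->
  locally_finite_family (bracket @` [set Q | finite_set Q /\ Q `<=` F]).
Proof.
move=> lF A.
have [V [oV AV fV]] : exists V, [/\ open V, proj1_sig A `<=` V &
    finite_set [set B | F B /\ B `&` V !=set0]].
  apply: (compact_ind (K := proj1_sig A) (Phi := fun C => exists V,
      [/\ open V, C `<=` V & finite_set [set B | F B /\ B `&` V !=set0]])).
  - by have [] := P_cpt (proj2_sig A).
  - exists set0; split=> //; first exact: open0.
    by rewrite (_ : [set _ | _] = set0) // -subset0 => B [_ [y []]].
  - move=> C D [V [oV CV fV]] [W [oW DW fW]]; exists (V `|` W); split.
    + exact: openU.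
    + exact: setUSS.
    + have := conj fV fW; rewrite -finite_setU; apply: sub_finite_set.
      by move=> B [FB [y [By [Vy|Wy]]]]; [left|right]; split=> //; exists y.
  - by move=> C D CD [V [oV DV fV]]; exists V; split=> //; exact: subset_trans DV.
  - move=> x _; have [N [/nbhs_open[W [oW Wx WN]] fN]] := lF x.
    exists W; first exact: open_nbhs_nbhs.
    exists W; split=> //.
    by apply: sub_finite_set fN => B [FB [y [By /WN Ny]]]; split=> //; exists y.
exists [set A : H | proj1_sig A `<=` V]; split.
  by apply: open_nbhs_nbhs; split=> //; exact: open_upper.
apply: sub_finite_set (finite_image bracket (finite_subsets fV)).
move=> _ [[Q [_ QF] <-] [C [[_ QC] CV]]]; exists Q => // B QB /=; split; first exact: QF.
by have [y [Cy By]] := QC B QB; exists y; split=> //; exact: CV.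
Qed.

(** Near each [A] in [K], a finite part [T] of the network of [X] is chosen so fine that every [L]
    in [K] close to [A] lies in the bracket of the members of [T] it meets, and that this bracket is
    inside [N]. *)
Lemma aleph_hyperspace : regular_space X -> aleph_space X -> aleph_space H.
Proof.
move=> rX [_ [[F0 [lF0 ->]] kF]].
have [F [lF Fmono FE]] := bigcup_increasing lF0 (@locally_finite_setU X).
rewrite {}FE {F0 lF0} in kF.
apply: (@aleph_countable _ _ (fun n : nat => bracket @` [set Q | finite_set Q /\ Q `<=` F n])).
  by move=> n; exact: locally_finite_bracket.
move=> K N cptK oN KN; pose C := \bigcup_(A in K) proj1_sig A.
have cptC : compact C := compact_bigcup_hyperspace cptK.
apply: (compact_ind (K := K) (Phi := fun K => exists Q, [/\ finite_set Q,
    Q `<=` \bigcup_n bracket @` [set Q | finite_set Q /\ Q `<=` F n],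
    K `<=` \bigcup_(A in Q) A & \bigcup_(A in Q) A `<=` N])) => //.
- by exists set0; split=> // x [].
- move=> A B [Q [fQ QF AQ QN]] [R [fR RF BR RN]]; exists (Q `|` R).
  by rewrite finite_setU bigcup_setU; split=> //;
    [rewrite subUset|exact: setUSS|rewrite subUset].
- by move=> A B AB [Q [fQ QF BQ QN]]; exists Q; split=> //; exact: subset_trans BQ.
move=> A KA.
have [U [s [oU AU sA sN]]] := hyperspace_nbhs (open_nbhs_nbhs (conj oN (KN A KA))).
have [V [oV AV VU]] := regular_compact rX (P_cpt (proj2_sig A)).1 oU AU.
have cover W V' : open W -> closure V' `<=` W -> exists Q, [/\ finite_set Q,
    Q `<=` \bigcup_n F n, C `&` closure V' `<=` \bigcup_(B in Q) B &
    \bigcup_(B in Q) B `<=` W].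
  move=> oW VW; apply: kF => //; last by move=> x [_ /VW].
  by apply: compact_closedI => //; exact: closed_closure.
have [Q0 [fQ0 Q0F CQ0 Q0U]] := cover _ _ oU VU.
(* Each meeting condition [G] holds at some [x] in [A]; covering the part of [C] near [x] by members
   inside [U] and [G] forces every nearby [L] in [K] to meet a member contained in [G]. *)
have [W [Q [oW WA [fQ QF QU] WQ]]] : exists (W : set H) (Q : set_system X), [/\ open W, W A,
    [/\ finite_set Q, Q `<=` \bigcup_n F n & \bigcup_(B in Q) B `<=` U] &
    forall L, W L -> K L -> forall G, G \in s ->
      exists2 B, Q B & proj1_sig L `&` B !=set0 /\ B `<=` G].
  elim: s sA {sN} => [_|G s IH sA].
    by exists setT, set0; split=> //; [exact: openT|split=> // x []].
  have [|W [Q [oW WA [fQ QF QU] WQ]]] := IH.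
    by move=> G' sG'; apply: sA; rewrite inE sG' orbT.
  have [oG [x [Ax Gx]]] := sA G (mem_head _ _).
  have [V' [oV' V'x V'G]] := regular_open rX (openI oU oG) (conj (AU x Ax) Gx).
  have [R [fR RF CR RU]] := cover _ _ (openI oU oG) V'G.
  exists (W `&` [set L | proj1_sig L `&` V' !=set0]), (Q `|` R); split.
  - by apply: openI => //; exact: open_lower.
  - by split=> //; exists x.
  - rewrite finite_setU bigcup_setU !subUset; split=> //.
    by split=> // y /RU [].
  - move=> L [WL [y [Ly V'y]]] KL G'; rewrite inE => /orP[/eqP ->|sG']; last first.
      by have [B QB hB] := WQ L WL KL G' sG'; exists B => //; left.
    have [|B RB By] := CR y; first by split; [exists L|exact: subset_closure].
    exists B; first by right.
    by split; [exists y|move=> z Bz; have [] := RU z (ex_intro2 _ _ B RB Bz)].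
pose T := Q0 `|` Q.
have fT : finite_set T by rewrite finite_setU.
have TU : \bigcup_(B in T) B `<=` U by rewrite bigcup_setU subUset.
have [n Tn] : exists n, T `<=` F n.
  by apply: finite_set_sub_bigcup => //; rewrite subUset.
exists (W `&` [set L | proj1_sig L `<=` V]).
  apply: open_nbhs_nbhs; split; last by split.
  by apply: openI => //; exact: open_upper.
exists (bracket @` [set R | R `<=` T] `&` [set M | M `<=` N]); split.
- by apply: finite_setIl; exact/finite_image/finite_subsets.
- move=> _ [[R RT <-] _]; exists n => //; exists R => //; split.
    exact: sub_finite_set fT.
  exact: subset_trans Tn.
- move=> L [[WL LV] KL]; pose R := [set B | T B /\ proj1_sig L `&` B !=set0].
  exists (bracket R).
    split; first by exists R => // B [].
    move=> M [MR RM]; apply: sN.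
      by move=> x /MR [B [TB _] Bx]; apply: TU; exists B.
    move=> G sG; have [B QB [LB BG]] := WQ L WL KL G sG.
    have [|y [My By]] := RM B; first by split=> //; right.
    by exists y; split=> //; exact: BG.
  split=> [x Lx|B []//].
  have [|B QB Bx] := CQ0 x; first by split; [exists L|exact/subset_closure/LV].
  by exists B => //; split; [left|exists x].
- by move=> M [B [_ BN] /BN].
Qed.

End aleph_hyperspace.

(** * From hyperspaces back to [X] *)

Section aleph_from_hyperspace.
Variables (X : topologicalType) (P : set X -> Prop).
Hypothesis P_cpt : forall A, P A -> cpt_ne A.
Hypothesis P_atmost2 : forall A, atmost2_ne A -> P A.
Hypotheses (hX : hausdorff_space X) (rX : regular_space X).
Local Notation H := (hyperspace P).

Let P_ne A : P A -> A !=set0. Proof. by move=> /P_cpt[]. Qed.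

(** A point of [A] outside the closed set [B] has an open [W] around it whose closure misses [B];
    meeting [W] and avoiding its closure are disjoint open conditions. *)
Lemma hausdorff_hyperspace : hausdorff_space H.
Proof.
have sep (A B : H) : ~ (proj1_sig A `<=` proj1_sig B) ->
    exists U V, [/\ open U, open V, U A, V B & U `&` V = set0].
  move=> /existsNP[x /not_implyP[Ax nBx]].
  have oB : open (~` proj1_sig B).
    exact: closed_openC (compact_closed hX (P_cpt (proj2_sig B)).1).
  have [W [oW Wx WB]] := regular_open rX oB nBx.
  exists [set L | proj1_sig L `&` W !=set0], [set L | proj1_sig L `<=` ~` closure W].
  split; first exact: open_lower.
  - by apply: open_upper => //; exact/closed_openC/closed_closure.
  - by exists x.
  - by move=> y By /WB.
  - by rewrite -subset0 => L [[y [Ly Wy]] /(_ y Ly)]; apply; exact: subset_closure.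
rewrite open_hausdorff => A B /eqP AB.
have [AsB|/sep[U [V [oU oV UA VB UV]]]] := pselect (proj1_sig A `<=` proj1_sig B); last first.
  by exists (U, V); [split; exact: mem_set|split=> //; exact/eqP].
have [BsA|/sep[U [V [oU oV UB VA UV]]]] := pselect (proj1_sig B `<=` proj1_sig A); last first.
  by exists (V, U); [split; exact: mem_set|split=> //; rewrite setIC; exact/eqP].
case: AB; case: A B AsB BsA => [A PA] [B PB] /= AB BA.
by apply: eq_exist; apply/seteqP.
Qed.

Definition doubleton (p : X * X) : H :=
  exist P ([set p.1] `|` [set p.2])
    (P_atmost2 (ex_intro _ p.1 (ex_intro _ p.2 erefl))).

Lemma doubleton_continuous : continuous doubleton.
Proof.
move=> [x y] N /hyperspace_nbhs[U [s [oU xyU sxy sN]]].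
suff : nbhs (x, y) [set q : X * X | forall V, V \in s ->
    proj1_sig (doubleton q) `&` V !=set0].
  move=> xys.
  have Uxy : nbhs (x, y) (U `*` U).
    by exists (U, U) => //; split; apply: open_nbhs_nbhs; split=> //;
      apply: xyU; [left|right].
  apply: filterS (filterI Uxy xys) => q [[Uq1 Uq2] qs].
  by apply: sN => // z [->|->].
elim: s sxy {sN xyU} => [_|V s IH sxy].
  by apply: filterS filterT => q _ V.
have {}IH : nbhs (x, y) [set q : X * X | forall W, W \in s ->
    proj1_sig (doubleton q) `&` W !=set0].
  by apply: IH => W Ws; apply: sxy; rewrite inE Ws orbT.
have [oV [z [xyz Vz]]] := sxy V (mem_head _ _).
have hV : nbhs (x, y) [set q : X * X | proj1_sig (doubleton q) `&` V !=set0].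
  case: xyz Vz => -> Vz.
    have : nbhs (x, y) (V `*` [set: X]).
      by exists (V, setT) => //; split; [exact: open_nbhs_nbhs|exact: filterT].
    by apply: filterS => q [Vq _]; exists q.1; split=> //; left.
  have : nbhs (x, y) ([set: X] `*` V).
    by exists (setT, V) => //; split; [exact: filterT|exact: open_nbhs_nbhs].
  by apply: filterS => q [_ Vq]; exists q.2; split=> //; right.
by apply: filterS (filterI hV IH) => q [Vq sq] W; rewrite inE => /orP[/eqP ->|/sq].
Qed.

(** The map [x |-> {x}] is an embedding, and preimages along it carry both HCP and the network
    property to [X]. *)
Lemma sigma_HCP_singleton :
  (exists Pf : set_system H, sigma_HCP Pf /\ k_network Pf) ->
  exists F : nat -> set_system X, [/\ forall n, HCP (F n),
    forall m n, m <= n -> F m `<=` F n & k_network (\bigcup_n F n)].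
Proof.
move=> [_ [[F0 [hF0 ->]] kF]].
have [F [hF Fmono FE]] := bigcup_increasing hF0 (@HCP_setU H).
rewrite {}FE {F0 hF0} in kF.
pose f (x : X) := doubleton (x, x).
have fcont : continuous f.
  move=> x; apply: (@continuous_comp _ _ _ (fun x => (x, x)) doubleton).
    by apply: cvg_pair => //=; exact: cvg_id.
  exact: doubleton_continuous.
exists (fun n => (fun A => f @^-1` A) @` F n); split.
- move=> n; apply: HCP_preimage => // x U /nbhs_open[V [oV Vx VU]].
  exists [set A : H | proj1_sig A `<=` V].
    by apply: open_nbhs_nbhs; split; [exact: open_upper|move=> y [->|->]].
  by move=> y fy; apply/VU/fy; left.
- by move=> m n /Fmono FF _ [A /FF FA <-]; exists A.
- move=> K U cptK oU KU.
  have [|||Q [fQ QF KQ QU]] := kF (f @` K) [set A : H | proj1_sig A `<=` U].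
  + by apply: continuous_compact => //; exact: continuous_subspaceT.
  + exact: open_upper.
  + by move=> _ [x Kx <-] y [->|->]; exact: KU.
  exists ((fun A => f @^-1` A) @` Q); split.
  + exact: finite_image.
  + by move=> _ [A /QF[n _ FA] <-]; exists n => //; exists A.
  + move=> x Kx; have [|A QA Afx] := KQ (f x); first by exists x.
    by exists (f @^-1` A) => //; exists A.
  + move=> x [_ [A QA <-] Afx]; have /(_ x) : proj1_sig (f x) `<=` U.
      by apply: QU; exists A.
    by apply; left.
Qed.

(** The new network is indexed by triples [(n, i, l)]: a stage of the network of [H], the second
    point [c i], and a stage of the network of [X] supplying a closed set [E n i l] free of the
    points where the traces fail to be point-finite. *)
Lemma aleph_of_hyperspace :
  (exists Pf : set_system H, sigma_HCP Pf /\ k_network Pf) -> aleph_space X.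
Proof.
move=> hPf.
have [G [hG Gmono kG]] := sigma_HCP_singleton hPf.
have [cptfin|] := pselect (forall K : set X, compact K -> finite_set K).
  apply: aleph_finite_compacts => //.
  by exists (\bigcup_n G n); split=> //; exists G.
move=> /existsNP[C /not_implyP[cptC infC]].
have [c [cinj Cc]] := infinite_choice (fun=> infC).
have [a ac] := compact_accumulation cptC Cc.
have [_ [[F0 [hF0 ->]] kF]] := hPf.
have [F [hF Fmono FE]] := bigcup_increasing hF0 (@HCP_setU H).
rewrite {}FE {F0 hF0} in kF.
pose f i (y : X) := doubleton (y, c i).
have fcont i : continuous (f i).
  move=> y; apply: (@continuous_comp _ _ _ (fun y => (y, c i)) doubleton).
    by apply: cvg_pair => //=; exact: cvg_cst.
  exact: doubleton_continuous.
have finit i x U : nbhs x U -> exists2 V, nbhs (f i x) V & f i @^-1` V `<=` U.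
  move=> /nbhs_open[W [oW Wx WU]].
  (* At [x = c i], containment in [W] controls [y]; elsewhere, a neighbourhood of [x] that excludes
     [c i] can only be met by [y]. *)
  have [xc|/(hausdorff_sep hX)[W' [oW' W'x ncW']]] := pselect (x = c i).
    exists [set A : H | proj1_sig A `<=` W].
      by apply: open_nbhs_nbhs; split; [exact: open_upper|move=> z [->|->] //=; rewrite -xc].
    by move=> y fy; apply/WU/fy; left.
  exists [set A : H | proj1_sig A `&` (W `&` W') !=set0].
    apply: open_nbhs_nbhs; split; first by apply: open_lower => //; exact: openI.
    by exists x; split; [left|split].
  move=> y [z [[->|->] [Wz W'z]]]; first exact: WU.
  by case: ncW'; exact: subset_closure.
pose T n i := (fun A => f i @^-1` A) @` F n.
have hT n i : HCP (T n i) := HCP_preimage (fcont i) (finit i) (hF n).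
pose E n i l := \bigcup_(B in [set B | G l B /\
  closure B `&` non_point_finite (T n i) = set0]) closure B.
apply: (@aleph_countable _ _ (fun q : nat * nat * nat =>
  (fun A => closure A `&` E q.1.1 q.1.2 q.2) @` T q.1.1 q.1.2)).
  move=> [[n i] l] /=; apply: locally_finite_closureI => //.
    by apply: (HCP_bigcup_closed (hG l)) => B [].
  rewrite -subset0 => x [[B [_ BT] Bx] Tx].
  by have : set0 x by rewrite -BT.
move=> K U cptK oU KU.
(* The final sets involve closures, so the members are kept inside a [V] whose closure lies in
   [U]. *)
have [V [oV KV VU]] := regular_compact rX cptK oU KU.
(* [N] must contain [{y, z}] for [y] in [K] and [z] near [a], yet force [y] into [V]. If [a] is in
   [V], take the sets contained in [V]; otherwise the sets meeting some [V'], from which [W] is kept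
   apart. *)
have [W [N [cW aW oN [KWN NV]]]] : exists (W : set X) (N : set H), [/\ closed W, nbhs a W, open N &
    (forall y z, K y -> W z -> N (doubleton (y, z))) /\
    (forall y z, N (doubleton (y, z)) -> W z -> V y)].
  have [Va|nVa] := pselect (V a).
    have [W [oW Wa WV]] := regular_open rX oV Va.
    exists (closure W), [set A : H | proj1_sig A `<=` V]; split.
    + exact: closed_closure.
    + by apply: filterS (open_nbhs_nbhs (conj oW Wa)); exact: subset_closure.
    + exact: open_upper.
    + split=> [y z Ky Wz t [->|->]|y z yzV _]; [exact: KV|exact: WV|].
      by apply: yzV; left.
  have oVa : open (V `&` ~` [set a]).
    by apply: openI => //; exact: closed_openC (compact_closed hX (@compact_set1 _ a)).
  have [|V' [oV' KV' V'V]] := regular_compact rX cptK oVa.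
    by move=> y Ky; split; [exact: KV|move=> ya; apply: nVa; rewrite -ya; exact: KV].
  have [||W [oW Wa WV']] := @regular_open _ a (~` closure V') rX.
  + exact/closed_openC/closed_closure.
  + by move=> /V'V[].
  exists (closure W), [set A : H | proj1_sig A `&` V' !=set0]; split.
  + exact: closed_closure.
  + by apply: filterS (open_nbhs_nbhs (conj oW Wa)); exact: subset_closure.
  + exact: open_lower.
  + split=> [y z Ky Wz|y z [t [[->|->] V't]] Wz].
    * by exists y; split; [left|exact: KV'].
    * by have [] := V'V y (subset_closure V't).
    * by case: (WV' z Wz); exact: subset_closure.
pose L := doubleton @` (K `*` (C `&` W)).
have cptL : compact L.
  apply: continuous_compact; first exact/continuous_subspaceT/doubleton_continuous.
  by apply: compact_setX => //; exact: compact_closedI.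
have LN : L `<=` N by move=> _ [[y z] [Ky [_ Wz]] <-]; exact: KWN.
have [Q [fQ QF LQ QN]] := kF L N cptL oN LN.
have [n Qn] := finite_set_sub_bigcup Fmono fQ QF.
(* If every [c i] in [W] were bad, each would belong to one of the finitely many elements of
   [non_point_finite (F n)] in [L]. These have at most two points each and [c] is injective, so only
   finitely many [c i] would lie in [W], although [c] accumulates at [a]. *)
have [i Wi Ki] : exists2 i, W (c i) & K `&` non_point_finite (T n i) = set0.
  apply: contrapT => nW.
  have badK i : W (c i) -> exists2 y, K y & non_point_finite (F n) (f i y).
    move=> Wi; apply: contrapT => nK; apply: nW; exists i => //.
    rewrite -subset0 => y [Ky /(non_point_finite_preimage (fcont i)) Dy].
    by apply: nK; exists y.
  apply: (ac W aW); have fD := finite_non_point_finite hausdorff_hyperspace (hF n) cptL.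
  apply: (@sub_finite_set _ _ (\bigcup_(A in non_point_finite (F n) `&` L)
      [set i | proj1_sig A (c i)])).
    move=> i /= Wi; have [y Ky Dy] := badK i Wi.
    have Lfy : L (f i y) by exists (y, c i) => //; split=> //; split=> //; exact: Cc.
    by exists (f i y); [split|right].
  apply: bigcup_finite => // _ [_ [[y z] _ <-]].
  have := conj (finite_fiber y cinj) (finite_fiber z cinj).
  by rewrite -finite_setU; apply: sub_finite_set.
(* The bad set is closed and misses [K], so regularity separates them, and the network of [X] covers
   [K] by finitely many members whose closures avoid the bad set. *)
have [l KE] : exists l, K `<=` E n i l.
  have oD : open (~` non_point_finite (T n i)).
    exact/closed_openC/closed_non_point_finite.
  have [|V' [oV' KV' V'D]] := regular_compact rX cptK oD.
    by move=> y Ky Dy; have : set0 y by rewrite -Ki.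
  have [R [fR RG KR RV']] := kG K V' cptK oV' KV'.
  have [l Rl] := finite_set_sub_bigcup Gmono fR RG.
  exists l => y Ky; have [B RB By] := KR y Ky.
  exists B; last exact: subset_closure.
  split; first exact: Rl.
  rewrite -subset0 => z [Bz]; apply: V'D; apply: closureS z Bz.
  by move=> z Bz; apply: RV'; exists B.
exists ((fun A => closure (f i @^-1` A) `&` E n i l) @` Q); split.
- exact: finite_image.
- move=> _ [A QA <-]; exists (n, i, l) => //=.
  by exists (f i @^-1` A) => //; exists A => //; exact: Qn.
- move=> y Ky; have [|A QA Afy] := LQ (f i y).
    by exists (y, c i) => //; split=> //; split=> //; exact: Cc.
  exists (closure (f i @^-1` A) `&` E n i l); first by exists A.
  by split; [exact: subset_closure|exact: KE].
- move=> y [_ [A QA <-] [Ay _]]; apply: VU; apply: closureS Ay => z Az.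
  by apply: (NV _ (c i)) => //; apply: QN; exists A.
Qed.

End aleph_from_hyperspace.

(** * The equivalences for hyperspaces between [F_2(X)] and [K(X)] *)

Lemma aleph_hyperspaceP (X : topologicalType) (P : set X -> Prop) :
  hausdorff_space X -> regular_space X ->
  (forall A, atmost2_ne A -> P A) -> (forall A, P A -> cpt_ne A) ->
  (aleph_space X <->
     exists Pf : set_system (hyperspace P), sigma_HCP Pf /\ k_network Pf) /\
  (aleph_space X <-> aleph_space (hyperspace P)).
Proof.
move=> hX rX P2 Pc.
have up := aleph_hyperspace Pc rX; have down := aleph_of_hyperspace Pc P2 hX rX.
split; split=> [/up //|]; first exact: aleph_sigma_HCP.
- exact: down.
- by move=> /aleph_sigma_HCP; exact: down.
Qed.

Lemma atmost2_fin_ne (X : topologicalType) (A : set X) : atmost2_ne A -> fin_ne A.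
Proof.
by move=> [x [y ->]]; split; [exact: finite_set2|exists x; left].
Qed.

Lemma fin_cpt_ne (X : topologicalType) (A : set X) : fin_ne A -> cpt_ne A.
Proof. by move=> [fA A0]; split=> //; exact: finite_compact. Qed.

Theorem theorem3p7 (X : topologicalType) :
  hausdorff_space X -> regular_space X ->
  [/\ (aleph_space X <->
         exists Pf : set_system (hyperF2 X), sigma_HCP Pf /\ k_network Pf),
      (aleph_space X <->
         exists Pf : set_system (hyperF X), sigma_HCP Pf /\ k_network Pf),
      (aleph_space X <-> aleph_space (hyperF X)) &
      (aleph_space X <-> aleph_space (hyperK X))].
Proof.
move=> hX rX.
have [F2 _] := aleph_hyperspaceP hX rX (fun A => id)
  (fun A (A2 : atmost2_ne A) => fin_cpt_ne (atmost2_fin_ne A2)).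
have [F F'] := aleph_hyperspaceP hX rX (@atmost2_fin_ne X) (@fin_cpt_ne X).
have [_ K] := aleph_hyperspaceP hX rX
  (fun A (A2 : atmost2_ne A) => fin_cpt_ne (atmost2_fin_ne A2)) (fun A => id).
by [].
Qed.
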